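(* Let $P,Q$ be integers with $P\ge 2$, $Q\neq 0$, $-P-1\le Q\le P-1$ and $D=P^2-4Q>0$, let $\alpha=\frac{P+\sqrt D}{2}$, $\beta=\frac{P-\sqrt D}{2}$ with $\alpha/\beta$ not a root of unity. Let $(a,b,c,d)\in A$, put $e=d/c$ and $$B_0=\min_{I\in\mathbb Z}\left|\alpha^I-\frac{d}{c\sqrt D}\right|.$$ Then $B_0\neq 0$ unless one of the following holds (where $I$ is the integer with $\alpha^I=\frac{d}{c\sqrt D}$): - $P=3,Q=2$ (so $\alpha=2$, $\sqrt D=1$), $e=1$, $I=0$; - $P=3,Q=2$ (so $\alpha=2$, $\sqrt D=1$), $e=2$, $I=1$; - $P=4,Q=3$ (so $\alpha=3$, $\sqrt D=2$), $e=2$, $I=0$; - $P=5,Q=4$ (so $\alpha=4$, $\sqrt D=3$), $e=3$, $I=0$.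
   Context: $A=\{(1,1,1,1),(1,1,1,3),(1,1,2,2),(1,1,2,4),(1,2,3,6),(1,1,5,5)\}$; note that $e=d/c\in\{1,2,3\}$ for tuples in $A$. *)

(* Defs.v *)
From HB Require Import structures.
From mathcomp Require Import all_boot all_order all_algebra.
From mathcomp Require Import all_classical all_reals.

Set Implicit Arguments.
Unset Strict Implicit.
Unset Printing Implicit Defensive.

Import Order.TTheory GRing.Theory Num.Theory.

Local Open Scope ring_scope.
Local Open Scope classical_set_scope.

Definition tuplesA : seq (nat * nat * nat * nat) :=
  [:: (1, 1, 1, 1); (1, 1, 1, 3); (1, 1, 2, 2);
      (1, 1, 2, 4); (1, 2, 3, 6); (1, 1, 5, 5)]%N.

Definition disc (P Q : int) : int := P ^+ 2 - 4 * Q.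

Section RealQuantities.
Variable R : realType.
Implicit Types P Q : int.

Definition sqrtD P Q : R := Num.sqrt (disc P Q)%:~R.

Definition alpha P Q : R := (P%:~R + sqrtD P Q) / 2.

Definition beta P Q : R := (P%:~R - sqrtD P Q) / 2.

(* The bound [0 < n] is needed: every element is a [0.-unity_root]. *)
Definition is_root_of_unity (x : R) : Prop :=
  exists2 n : nat, (0 < n)%N & n.-unity_root x.

Definition is_min (S : set R) (m : R) : Prop := S m /\ lbound S m.

(* The set of values |alpha^I - d / (c sqrt D)|, I ranging over all integers,
   negative ones included. *)
Definition distances P Q (c d : nat) : set R :=
  range (fun I : int => `|alpha P Q ^ I - d%:R / (c%:R * sqrtD P Q)|).

Definition exceptional P Q (e : R) (I : int) : Prop :=
  [\/ [/\ P = 3, Q = 2, e = 1 & I = 0],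
      [/\ P = 3, Q = 2, e = 2 & I = 1],
      [/\ P = 4, Q = 3, e = 2 & I = 0]
    | [/\ P = 5, Q = 4, e = 3 & I = 0]].

End RealQuantities.

Arguments distances R P Q c d : clear implicits.

(* Main.v *)
(* The bounds on Q give sqrt D >= 4 - P and sqrt D <= P + 2, that is,
   alpha >= 2 and sqrt D = alpha - beta <= alpha + 1. Hence alpha^I sqrt D = e
   with e in {1, 2, 3} forces I to be 0 or 1: for I >= 2 the left-hand side is
   at least 4, for I <= -2 it is at most (alpha + 1) / alpha^2 < 1, and for
   I = -1 it reads beta = (1 - e) alpha, against 0 < |beta| < alpha. For
   I = 0 and I = 1, (P - 2)^2 <= D leaves finitely many P. *)

Require Import Defs.
From mathcomp Require Import all_boot all_order all_algebra.
From mathcomp Require Import all_classical all_reals.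
From mathcomp Require Import lra zify.

Import Order.TTheory GRing.Theory Num.Theory.
Local Open Scope ring_scope.

Lemma bernoulli_le (R : numDomainType) (x : R) (n : nat) :
  0 <= x -> 1 + x *+ n <= (1 + x) ^+ n.
Proof.
move=> x0; elim: n => [|n IH]; first by rewrite mulr0n addr0.
rewrite exprSr; apply: le_trans (ler_wpM2r _ IH); last by rewrite addr_ge0.
rewrite mulrDl mul1r mulrDr mulr1 mulrS -addrA lerD2l lerD2l.
by rewrite lerDl mulr_ge0 ?mulrn_wge0.
Qed.

Lemma expr_unbounded (R : archiRealFieldType) (x t : R) :
  1 < x -> exists n : nat, t < x ^+ n.
Proof.
move=> x1; have y0 : 0 < x - 1 by rewrite subr_gt0.
(* Bernoulli gives [1 + n (x - 1) <= x ^+ n], so any [n] above [|t| / (x - 1)] works. *)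
exists (Num.bound (`|t| / (x - 1))).
have /archi_boundP : 0 <= `|t| / (x - 1) by rewrite divr_ge0 // ltW.
rewrite ltr_pdivrMr // mulr_natl => tn.
apply: le_lt_trans (ler_norm t) (lt_le_trans tn _).
have := @bernoulli_le _ _ (Num.bound (`|t| / (x - 1))) (ltW y0).
rewrite [1 + (x - 1)]addrC subrK; apply: le_trans.
by rewrite lerDr.
Qed.

Lemma exprz_bracket (R : archiRealFieldType) (x t : R) :
  1 < x -> 0 < t -> exists n : int, x ^ n <= t < x ^ (n + 1).
Proof.
move=> x1 t0; have x0 : x != 0 by rewrite gt_eqF // (lt_trans ltr01).
have [m mP] := @expr_unbounded _ x t^-1 x1.
have xm0 : 0 < x ^+ m by rewrite exprn_gt0 // (lt_trans ltr01).
have lo : x ^ (- m%:Z) < t by rewrite -exprnN invf_plt.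
have [k kP] := @expr_unbounded _ x t x1.
(* Shifting exponents by [m] reduces the search to a least natural number; it is not 0 because
   [x ^ (- m) < t], so its predecessor gives the lower bound. *)
have ex : exists n : nat, t < x ^ (n%:Z - m%:Z).
  by exists (k + m)%N; rewrite PoszD addrK.
case: (ex_minnP ex) => -[|n] nP nmin.
  by move: nP; rewrite sub0r ltNge (ltW lo).
exists (n%:Z - m%:Z); rewrite addrAC -[1 : int]/(1%N : int) -PoszD addn1 nP.
rewrite andbT leNgt; apply/negP => /nmin.
by rewrite ltnn.
Qed.

(** Powers of [x] increase with the exponent, so one of the two consecutive powers around [t] is
    nearest. This shows that the minimum over all integers is attained. *)
Lemma dist_exprz_min (R : archiRealFieldType) (x t : R) : 1 < x -> 0 < t ->
  exists n : int, forall m : int, `|x ^ n - t| <= `|x ^ m - t|.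
Proof.
move=> x1 t0; have [n /andP[nt tn]] := @exprz_bracket _ x t x1 t0.
have near m : `|x ^ n - t| <= `|x ^ m - t| \/
              `|x ^ (n + 1) - t| <= `|x ^ m - t|.
  have [mn|nm] := leP m n.
    left; have := ler_weXz2l (ltW x1) mn => xmn.
    by rewrite !ler0_norm; lra.
  right; have : x ^ (n + 1) <= x ^ m by rewrite ler_eXz2l // lezD1.
  by move=> xnm; rewrite !ger0_norm; lra.
have [le|/ltW le] := leP `|x ^ n - t| `|x ^ (n + 1) - t|.
  by exists n => m; case: (near m) => // /(le_trans le).
by exists (n + 1) => m; case: (near m) => // /(le_trans le).
Qed.

Section LucasRoots.
Variables (R : realType) (P Q : int).
Hypotheses (hP : 2 <= P) (hQ0 : Q != 0) (hQ : - P - 1 <= Q <= P - 1).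
Hypothesis hD : 0 < disc P Q.

Local Notation s := (sqrtD R P Q).
Local Notation al := (alpha R P Q).

Lemma sqr_sqrtD : s ^+ 2 = (disc P Q)%:~R.
Proof. by rewrite sqr_sqrtr // ler0z ltW. Qed.

Lemma sqrtD_gt0 : 0 < s.
Proof. by rewrite sqrtr_gt0 ltr0z. Qed.

Lemma intr_le_sqrtD (n : int) : n ^+ 2 <= disc P Q -> n%:~R <= s.
Proof.
rewrite -(ler_int R) -sqr_sqrtD rmorphXn /= => h.
by have := sqrtD_gt0; nra.
Qed.

Lemma sqrtD_le_intr (n : int) : 0 <= n -> disc P Q <= n ^+ 2 -> s <= n%:~R.
Proof.
rewrite -(ler0z R) -(ler_int R) -sqr_sqrtD rmorphXn /= => n0 h.
by have := sqrtD_gt0; nra.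
Qed.

Lemma sqrtD_intr (n : int) : 0 <= n -> (s == n%:~R) = (disc P Q == n ^+ 2).
Proof.
move=> n0; rewrite -(eqr_int R) -sqr_sqrtD rmorphXn /=.
by rewrite eqrXn2 ?ler0z // ltW // sqrtD_gt0.
Qed.

Lemma sqrtD_ge1 : 1 <= s.
Proof. by apply: (intr_le_sqrtD 1); rewrite expr1n. Qed.

Lemma alpha_ge2 : 2 <= al.
Proof.
have : (4 - P)%:~R <= s.
  (* The goal amounts to [Q <= 2 P - 4]: for [P >= 3] this follows from [Q <= P - 1], for [P = 2]
     from [D > 0]. *)
  apply: intr_le_sqrtD; move: hD hP hQ hQ0; rewrite /disc !expr2.
  by have [->|] := eqVneq P 2; nia.
by rewrite rmorphB /= /alpha; lra.
Qed.

Lemma sqrtD_le_alphaD1 : s <= al + 1.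
Proof.
have : s <= (P + 2)%:~R.
  (* Here [D <= (P + 2)^2] is exactly [- P - 1 <= Q]. *)
  by apply: sqrtD_le_intr; move: hP hQ; rewrite /disc ?expr2; nia.
by rewrite rmorphD /= /alpha; lra.
Qed.

(** Equality would mean [beta = 0], hence [D = P^2] and [Q = 0]. *)
Lemma sqrtD_neq_alpha : s != al.
Proof.
apply/eqP => sal.
have /eqP : s = P%:~R by move: sal; rewrite /alpha; lra.
by rewrite sqrtD_intr; move: hP hQ0; rewrite /disc ?expr2; lia.
Qed.

Lemma sqrtD_lt_2alpha : s < 2 * al.
Proof.
have : (0 : R) < P%:~R by rewrite ltr0z; move: hP; lia.
by rewrite /alpha; lra.
Qed.

Lemma sqrtD_exceptional (n : nat) :
  (1 <= n <= 3)%N -> s = n%:R -> exceptional P Q (n%:R : R) 0.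
Proof.
move=> n13 /eqP; rewrite -[n%:R]/(n%:Z%:~R) sqrtD_intr // => /eqP.
move: hP hQ hQ0; rewrite /disc !expr2 => P2 QP Q0 Dn.
have {}P5 : P <= 5 by move: n13 Dn; nia.
have {P2 P5} : P = 2 \/ P = 3 \/ P = 4 \/ P = 5 by lia.
case: n n13 Dn => [|[|[|[|n]]]] // _ Dn PE.
(* [D = n^2] forces [P] and [n] to have the same parity. [P = n] would give [Q = 0], and [P = 5],
   [n = 1] would give [Q = 6 > P - 1]; only [P = n + 2] survives. *)
- by apply: Or41; split=> //; move: PE Dn QP => [|[|[|]]] ->; lia.
- by apply: Or43; split=> //; move: PE Dn QP => [|[|[|]]] ->; lia.
- by apply: Or44; split=> //; move: PE Dn QP => [|[|[|]]] ->; lia.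
Qed.

Lemma alpha_sqrtD_exceptional (n : nat) :
  (1 <= n <= 3)%N -> al * s = n%:R -> exceptional P Q (n%:R : R) 1.
Proof.
move=> /andP[_ n3] alsn.
(* From [al >= 2] and [n <= 3], [s <= 3/2], so [D <= 9/4]. *)
have D3 : disc P Q < 3.
  rewrite -(ltr_int R) -sqr_sqrtD.
  have : (n%:R : R) <= 3 by rewrite ler_nat.
  by rewrite -alsn; have := alpha_ge2; have := sqrtD_gt0; nra.
have [PE QE] : P = 3 /\ Q = 2.
  move: hP hQ hD D3; rewrite /disc !expr2 => P2 QP D0 D3.
  have P3 : P <= 3 by nia.
  (* Modulo 4, [D] is 0 for [P = 2], which is impossible for [0 < D < 3], and 1 for [P = 3], so that
     [D = 1]. *)
  have [PE|PE] : P = 2 \/ P = 3 by lia.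
    by rewrite PE in D0 D3; lia.
  by rewrite PE in D0 D3 QP *; lia.
have sE : s = 1.
  by apply/eqP; rewrite -[1]/(1%:~R) sqrtD_intr // /disc PE QE.
by apply: Or42; split=> //; rewrite -alsn /alpha sE PE; lra.
Qed.

Lemma alpha_exprz_exceptional (n : nat) (I : int) :
  (1 <= n <= 3)%N -> al ^ I * s = n%:R -> exceptional P Q (n%:R : R) I.
Proof.
move=> n13; have /andP[n1 n3] := n13; have al2 := alpha_ge2.
have nR1 : (1 : R) <= n%:R by rewrite ler1n.
have nR3 : (n%:R : R) <= 3 by rewrite ler_nat.
have sq_le (m : nat) : al ^+ 2 <= al ^+ m.+2.
  by rewrite ler_eXn2l //; lra.
(* The cases are [I = 0], [I = 1], [I = m + 2], [I = -1] and [I = - (m + 2)]; the last three are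
   contradictory. *)
case: I => [[|[|m]]|[|m]].
- by rewrite expr0z mul1r; exact: sqrtD_exceptional.
- by rewrite expr1z; exact: alpha_sqrtD_exceptional.
- rewrite -exprnP => alsn; have := sq_le m; have := sqrtD_ge1.
  by nra.
- rewrite NegzE exprN1 => alsn.
  have sE : s = n%:R * al by rewrite -alsn mulrAC mulVf ?mul1r //; lra.
  case: n n1 {n3 n13 nR1 nR3 alsn} sE => [//|[|n]] _ sE.
    by have := sqrtD_neq_alpha; rewrite sE mul1r eqxx.
  have : (2 : R) <= n.+2%:R by rewrite ler_nat.
  by have := sqrtD_lt_2alpha; rewrite sE; nra.
- rewrite NegzE -exprnN => alsn.
  have sE : s = n%:R * al ^+ m.+2.
    by rewrite -alsn mulrAC mulVf ?mul1r // expf_neq0 //; lra.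
  have := sqrtD_le_alphaD1; have := sq_le m; rewrite sE; nra.
Qed.
End LucasRoots.

(** [B0] is existentially quantified because attainment of the minimum is part of the claim. *)
Theorem theorem2 (R : realType) (P Q : int) (a b c d : nat)
  (hP : 2 <= P) (hQ0 : Q != 0) (hQ : - P - 1 <= Q <= P - 1)
  (hD : 0 < disc P Q)
  (hroot : ~ is_root_of_unity (alpha R P Q / beta R P Q))
  (hA : (a, b, c, d) \in tuplesA) :
  let e : R := d%:R / c%:R in
  exists B0 : R,
    [/\ is_min (distances R P Q c d) B0,
        ~ (exists I : int, exceptional P Q e I) -> B0 <> 0,
        forall I : int, exceptional P Q e I ->
          alpha R P Q ^ I = d%:R / (c%:R * sqrtD R P Q) /\
          (forall J : int,
             alpha R P Q ^ J = d%:R / (c%:R * sqrtD R P Q) -> J = I)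
      & [/\ P = 3 -> Q = 2 -> alpha R P Q = 2 /\ sqrtD R P Q = 1,
            P = 4 -> Q = 3 -> alpha R P Q = 3 /\ sqrtD R P Q = 2
          & P = 5 -> Q = 4 -> alpha R P Q = 4 /\ sqrtD R P Q = 3]].
Proof.
move=> e.
have [n n13 en] : exists2 n : nat, (1 <= n <= 3)%N & e = n%:R.
  have div (k : nat) : d = (k * c)%N -> c != 0%N -> e = k%:R.
    by move=> dE c0; rewrite /e dE natrM mulfK // pnatr_eq0.
  move: hA; rewrite !inE => /or4P[|||/or3P[]] /eqP[_ _ cE dE].
  - by exists 1%N => //; apply: div; rewrite cE ?dE.
  - by exists 3%N => //; apply: div; rewrite cE ?dE.
  - by exists 1%N => //; apply: div; rewrite cE ?dE.
  - by exists 2%N => //; apply: div; rewrite cE ?dE.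
  - by exists 2%N => //; apply: div; rewrite cE ?dE.
  - by exists 1%N => //; apply: div; rewrite cE ?dE.
have s0 : 0 < sqrtD R P Q by exact: sqrtD_gt0.
have al1 : 1 < alpha R P Q.
  by apply: (@lt_le_trans _ _ 2); [rewrite ltr1n | exact: alpha_ge2].
have values m : 0 <= m -> disc P Q = m ^+ 2 ->
    alpha R P Q = (P + m)%:~R / 2 /\ sqrtD R P Q = m%:~R.
  move=> m0 Dm; have sm : sqrtD R P Q = m%:~R.
    by apply/eqP; rewrite sqrtD_intr // Dm.
  by rewrite /alpha sm rmorphD.
have v3 : P = 3 -> Q = 2 -> alpha R P Q = 2 /\ sqrtD R P Q = 1.
  move=> PE QE; have [|//|-> ->] := values 1; rewrite ?PE ?QE //.
  by split=> //; lra.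
have v4 : P = 4 -> Q = 3 -> alpha R P Q = 3 /\ sqrtD R P Q = 2.
  move=> PE QE; have [|//|-> ->] := values 2; rewrite ?PE ?QE //.
  by split=> //; lra.
have v5 : P = 5 -> Q = 4 -> alpha R P Q = 4 /\ sqrtD R P Q = 3.
  move=> PE QE; have [|//|-> ->] := values 3; rewrite ?PE ?QE //.
  by split=> //; lra.
(* From here on [c] and [d] enter only through [e]. *)
rewrite /distances invfM mulrA -/e.
have [I0 I0min] : exists I0 : int, forall J : int,
    `|alpha R P Q ^ I0 - e / sqrtD R P Q| <=
    `|alpha R P Q ^ J - e / sqrtD R P Q|.
  by apply: dist_exprz_min; rewrite // divr_gt0 // en ltr0n; case/andP: n13.
exists `|alpha R P Q ^ I0 - e / sqrtD R P Q|; split=> //.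
- split; first by exists I0.
  by move=> _ [J _ <-].
- move=> nex /eqP; rewrite normr_eq0 subr_eq0 => /eqP eqI; apply: nex.
  exists I0; rewrite en; apply: alpha_exprz_exceptional => //.
  by rewrite eqI en divfK // gt_eqF.
- move=> I exc.
  have eqI : alpha R P Q ^ I = e / sqrtD R P Q.
    case: exc => -[PE QE -> ->].
    + by have [-> ->] := v3 PE QE; rewrite divr1.
    + by have [-> ->] := v3 PE QE; rewrite divr1.
    + by have [-> ->] := v4 PE QE; rewrite expr0z divff ?pnatr_eq0.
    + by have [-> ->] := v5 PE QE; rewrite expr0z divff ?pnatr_eq0.
  (* Uniqueness of the exponent: integer powers of a positive base other than 1 are injective. *)
  split=> // J; rewrite -eqI; apply: ieexprIz; last by rewrite gt_eqF.
  exact: lt_trans al1.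
Qed.
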